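(* The equation $$m\,\ddot x^\mu=e\,F^\mu{}_\nu\,\dot x^\nu-\tfrac23\,e^2\,\eta_{\rho\sigma}\ddot x^\rho\ddot x^\sigma\,\dot x^\mu$$ does not have run-away solutions.
   Context: $M$ is four-dimensional Minkowski spacetime with metric $\eta$ of signature $(-1,1,1,1)$, in a global normal coordinate system ($\eta$ constant diagonal), units with $c=1$. $m>0$ and $e\neq 0$ are the mass and charge. $A_{max}>0$ is a constant (maximal acceleration). World-lines are smooth future-oriented curves parameterized by the proper time $\tau$ of the metric of maximal acceleration $g=(1-\epsilon)\eta$, $\epsilon(\tau)=\eta(\ddot x,\ddot x)/A_{max}^2$, so that $g(\dot x,\dot x)=-1$; dots are derivatives with respect to $\tau$. Accelerations satisfy $0\le\eta(\ddot x,\ddot x)<A^2_{max}$ (the regime considered is $\epsilon\ll1$). $F=F_{\mu\nu}dx^\mu\wedge dx^\nu$ is a smooth electromagnetic 2-form (antisymmetric components), $F^\mu{}_\nu=\eta^{\mu\rho}F_{\rho\nu}$. A run-away solution is a solution, defined for all large $\tau$, for which the external electromagnetic force has compact domain in the spacetime (i.e. $F$ has compact support in $M$) and yet the charged particle keeps accelerating without end (i.e. $a^2(\tau)=\eta(\ddot x,\ddot x)\ne0$ for arbitrarily large $\tau$). *)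

(* Defs.v *)
From HB Require Import structures.
From mathcomp Require Import all_boot all_order all_algebra.
From mathcomp Require Import all_classical all_reals all_analysis.
Set Implicit Arguments.
Unset Strict Implicit.
Unset Printing Implicit Defensive.
Import Order.TTheory GRing.Theory Num.Theory.
Import numFieldNormedType.Exports.
Local Open Scope classical_set_scope.
Local Open Scope ring_scope.

Section Minkowski.
Context {R : realType}.

(* Coordinates are (x^0, x^1, x^2, x^3), with x^0 the time coordinate and
   c = 1; points and tangent vectors are both row vectors. *)
Definition spacetime := 'rV[R]_4.

Definition eta : 'M[R]_4 :=
  diag_mx (\row_mu (if mu == ord0 then -1 else 1)).

Definition eta_form (u v : spacetime) : R :=
  \sum_mu \sum_nu eta mu nu * u ord0 mu * v ord0 nu.

Fixpoint Ck (k : nat) (f : spacetime -> R) : Prop :=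
  continuous f /\
  if k is k'.+1 then
    forall mu, (forall p, derivable f p (delta_mx ord0 mu)) /\
               Ck k' (fun p => 'D_(delta_mx ord0 mu) f p)
  else True.

Definition smooth (f : spacetime -> R) : Prop := forall k, Ck k f.

(* [F p mu nu] is the covariant component F_{mu nu} at the event p. *)
Record em_field (F : spacetime -> 'M[R]_4) : Prop := {
  em_smooth : forall mu nu, smooth (fun p => F p mu nu);
  em_antisym : forall p mu nu, F p nu mu = - F p mu nu
}.

Definition compactly_supported (F : spacetime -> 'M[R]_4) : Prop :=
  compact (closure [set p | F p != 0]).

(* F^mu_nu; the entries of [invmx eta] are the eta^{mu rho}. *)
Definition raised (F : spacetime -> 'M[R]_4) (p : spacetime) : 'M[R]_4 :=
  \matrix_(mu, nu) \sum_rho invmx eta mu rho * F p rho nu.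

Definition velocity (x : R -> spacetime) (t : R) : spacetime := derive1n 1 x t.
Definition acceleration (x : R -> spacetime) (t : R) : spacetime := derive1n 2 x t.

Definition accel2 (x : R -> spacetime) (t : R) : R :=
  eta_form (acceleration x t) (acceleration x t).

Definition epsilon (Amax : R) (x : R -> spacetime) (t : R) : R :=
  accel2 x t / Amax ^+ 2.

Definition max_accel_metric (Amax : R) (x : R -> spacetime) (t : R)
    (u v : spacetime) : R :=
  (1 - epsilon Amax x t) * eta_form u v.

(* A world-line is a total function of which only the values on the open
   interval I matter: since I is open, the two-sided derivatives at points
   of I depend only on those values. *)
Record worldline (Amax : R) (I : set R) (x : R -> spacetime) : Prop := {
  wl_open : open I;
  wl_interval : is_interval I;
  wl_smooth : forall n t, I t -> derivable (derive1n n x) t 1;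
  wl_future : forall t, I t -> 0 < velocity x t ord0 ord0;
  wl_accel_ge0 : forall t, I t -> 0 <= accel2 x t;
  wl_accel_lt : forall t, I t -> accel2 x t < Amax ^+ 2;
  wl_proper : forall t, I t ->
    max_accel_metric Amax x t (velocity x t) (velocity x t) = -1
}.

Definition eq_of_motion (m e : R) (F : spacetime -> 'M[R]_4)
    (x : R -> spacetime) (t : R) : Prop :=
  forall mu : 'I_4,
    m * acceleration x t ord0 mu =
      e * (\sum_nu raised F (x t) mu nu * velocity x t ord0 nu)
      - 2 / 3 * e ^+ 2 * accel2 x t * velocity x t ord0 mu.

Record solution (m e Amax : R) (F : spacetime -> 'M[R]_4)
    (I : set R) (x : R -> spacetime) : Prop := {
  sol_worldline : worldline Amax I x;
  sol_eq : forall t, I t -> eq_of_motion m e F x t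
}.

Record runaway (m e Amax : R) (F : spacetime -> 'M[R]_4)
    (I : set R) (x : R -> spacetime) : Prop := {
  ra_solution : solution m e Amax F I x;
  ra_large_times : exists t0, `]t0, +oo[ `<=` I;
  ra_compact : compactly_supported F;
  ra_accelerates : forall T, exists t, [/\ T < t, I t & accel2 x t != 0]
}.

End Minkowski.

Arguments spacetime : clear implicits.

(* Main.v *)
(* Where F vanishes, m a = - (2/3) e^2 a^2 v; in Minkowski squares the left side
   is m^2 a^2 >= 0 and the right side a nonnegative multiple of eta(v, v) < 0,
   so a^2 = 0. Moreover eta(v, v) = - 1 / (1 - epsilon) <= -1 forces
   dx^0/dtau >= 1: the time coordinate is unbounded, and the particle leaves the
   compact support of F for good. *)
Require Import Defs.
From HB Require Import structures.
From mathcomp Require Import all_boot all_order all_algebra.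
From mathcomp Require Import all_classical all_reals all_analysis.
From mathcomp Require Import ring lra.
Import Order.TTheory GRing.Theory Num.Theory.
Import numFieldNormedType.Exports.
Local Open Scope classical_set_scope.
Local Open Scope ring_scope.

Section EtaForm.
Context {R : realType}.
Implicit Types u v : spacetime R.

Lemma eta_formE u v :
  eta_form u v = - (u ord0 ord0 * v ord0 ord0)
    + \sum_(i < 3) u ord0 (lift ord0 i) * v ord0 (lift ord0 i).
Proof.
(* Since the metric is diagonal, only the terms with equal indices survive. *)
have -> : eta_form u v = \sum_mu Defs.eta mu mu * u ord0 mu * v ord0 mu.
  apply: eq_bigr => mu _; rewrite (bigD1 mu)//= big1 ?addr0// => nu nu_mu.
  by rewrite !mxE [mu == nu]eq_sym (negbTE nu_mu) mulr0n !mul0r.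
rewrite big_ord_recl !mxE eqxx mulr1n mulN1r mulNr; congr (_ + _).
by apply: eq_bigr => i _; rewrite !mxE eqxx /= mulr1n mul1r.
Qed.

Lemma eta_formZ (a : R) u : eta_form (a *: u) (a *: u) = a ^+ 2 * eta_form u u.
Proof.
rewrite !eta_formE !mxE mulrDr mulr_sumr; congr (_ + _); first by ring.
by apply: eq_bigr => i _; rewrite !mxE; ring.
Qed.

Lemma eta_form_ge u : - u ord0 ord0 ^+ 2 <= eta_form u u.
Proof.
rewrite eta_formE expr2 lerDl sumr_ge0// => i _.
by rewrite -expr2 sqr_ge0.
Qed.

End EtaForm.

(** By the mean value theorem, [f t - f a >= t - a] for [t > a]. The base point [a] lies strictly
    beyond [t0], because nothing is known of [f] at [t0] itself. *)
Lemma unbounded_of_derive_ge1 (R : realType) (f : R -> R) (t0 B : R) :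
  (forall t, t0 < t -> derivable f t 1) ->
  (forall t, t0 < t -> 1 <= derive1 f t) ->
  exists T, forall t, T < t -> B < f t.
Proof.
move=> fd f1; pose a := t0 + 1.
have t0a : t0 < a by rewrite ltrDl.
(* The second bound solves [f a + (t - a) > B] for [t]. *)
exists (Num.max a (a + B - f a)) => t; rewrite gt_max => /andP[lat Bt].
have [||c] := @MVT _ f (derive1 f) a t lat.
- move=> s; rewrite in_itv/= => /andP[lt_as _].
  rewrite derive1E; apply: derivableP; exact/fd/(lt_trans t0a).
- apply: derivable_within_continuous => s; rewrite in_itv/= => /andP[le_as _].
  exact/fd/(lt_le_trans t0a).
rewrite in_itv/= => /andP[lt_ac _] fE.
have := f1 c (lt_trans t0a lt_ac).
by nra.
Qed.

(** The time coordinate is continuous, hence bounded on the compact support. *)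
Lemma compactly_supported_bounded_time (R : realType)
    (F : spacetime R -> 'M[R]_4) :
  compactly_supported F ->
  exists B, forall p : spacetime R, B < p ord0 ord0 -> F p = 0.
Proof.
pose time (p : spacetime R) := p ord0 ord0.
have time_cont : continuous time by exact: coord_continuous.
move=> /(continuous_compact (continuous_subspaceT time_cont)).
move=> /compact_bounded[N [_ HN]].
(* Boundedness supplies the estimate only for constants strictly above [N], hence [N + 1]. *)
exists (N + 1) => p pN; apply: contrapT => /eqP Fp0.
have Kp : closure [set q | F q != 0] p by exact: subset_closure.
have : `|time p| <= N + 1 by apply: (HN (N + 1)); [rewrite ltrDl | exists p].
by move=> /(le_trans (ler_norm _)); rewrite leNgt pN.
Qed.

Section Worldline.
Context {R : realType} {Amax : R} {I : set R} {x : R -> spacetime R}.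
Hypotheses (Amax0 : 0 < Amax) (wl : worldline Amax I x).

Lemma worldline_velocity_le t : I t ->
  eta_form (velocity x t) (velocity x t) <= -1.
Proof.
move=> It; have := wl_proper wl It; rewrite /max_accel_metric.
have e0 : 0 <= epsilon Amax x t by rewrite divr_ge0 ?sqr_ge0 ?(wl_accel_ge0 wl).
have e1 : epsilon Amax x t < 1.
  by rewrite ltr_pdivrMr ?exprn_gt0// mul1r (wl_accel_lt wl).
by nra.
Qed.

Lemma worldline_derivable_time t : I t ->
  derivable (fun s => x s ord0 ord0) t 1.
Proof. by move=> It; have /derivable_mxP := wl_smooth wl (n := 0) It. Qed.

Lemma worldline_derive_time_ge1 t : I t ->
  1 <= derive1 (fun s => x s ord0 ord0) t.
Proof.
move=> It.
have -> : derive1 (fun s => x s ord0 ord0) t = velocity x t ord0 ord0.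
  by rewrite /velocity derive1n1 !derive1E derive_mx ?mxE//; exact: (wl_smooth wl (n := 0) It).
have := wl_future wl It; have := worldline_velocity_le _ It.
(* With [v] the velocity, [- (v^0)^2 <= eta(v, v) <= -1] gives [(v^0)^2 >= 1]; future orientation
   selects [v^0 >= 1]. *)
by have := eta_form_ge (velocity x t); nra.
Qed.

Lemma free_accel2_eq0 (m e : R) (F : spacetime R -> 'M[R]_4) t :
  0 < m -> I t -> eq_of_motion m e F x t -> F (x t) = 0 -> accel2 x t = 0.
Proof.
move=> m0 It eom Fx0.
have aE : m *: acceleration x t = (- (2 / 3 * e ^+ 2 * accel2 x t)) *: velocity x t.
  apply/rowP => mu; rewrite !mxE eom big1 ?mulr0 ?sub0r ?mulNr// => nu _.
  by rewrite mxE big1 ?mul0r// => rho _; rewrite Fx0 mxE mulr0.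
have := congr1 (fun u => eta_form u u) aE; rewrite /= !eta_formZ -/(accel2 x t).
have := wl_accel_ge0 wl It; have := worldline_velocity_le _ It.
set A := accel2 x t; set w := eta_form _ _ => w1 A0 mA.
(* By [mA], the left side is a square times [w], and [w <= -1]. *)
have : m ^+ 2 * A <= 0 by rewrite mA mulr_ge0_le0 ?sqr_ge0 ?(le_trans w1).
by rewrite pmulr_rle0 ?exprn_gt0// => A0'; apply/eqP; rewrite eq_le A0' A0.
Qed.

End Worldline.

Theorem corollary6p5 (R : realType) (m e Amax : R)
    (F : spacetime R -> 'M[R]_4) :
  0 < m -> e != 0 -> 0 < Amax -> em_field F ->
  ~ exists (I : set R) (x : R -> spacetime R), runaway m e Amax F I x.
Proof.
move=> m0 _ Amax0 _ [I [x [[wl eom] [t0 t0I] Fcs acc]]].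
have [B FB] := compactly_supported_bounded_time _ _ Fcs.
have It t : t0 < t -> I t by move=> ?; apply: t0I; rewrite /= in_itv/= andbT.
have [T xT] := @unbounded_of_derive_ge1 R (fun s => x s ord0 ord0) t0 B
  (fun t h => worldline_derivable_time wl _ (It t h))
  (fun t h => worldline_derive_time_ge1 Amax0 wl _ (It t h)).
(* Past [T] the particle is later than every event of the support, so any acceleration there
   contradicts the free case. *)
have [t [Tt Itt /eqP]] := acc T; apply.
exact: (free_accel2_eq0 Amax0 wl _ _ _ _ m0 Itt (eom t Itt) (FB _ (xT t Tt))).
Qed.
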